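(* Let $\boldsymbol{A}$ be the algebra with universe $A=\{0,a_1,a_2,a_3,a_4,a_5,a_6,1\}$ obtained from the linearly ordered Heyting algebra $0<a_1<a_2<a_3<a_4<a_5<a_6<1$ (with basic operations $\wedge,\vee,\to,0,1$) by adding a constant symbol interpreted as $a_5$, two binary operations $+$ and $\ast$, and two unary operations $\Box$ and $\Diamond$, defined for all $a,b\in A$ by $$a+b=\begin{cases} a_6 & \text{if } a=0 \text{ and } b\in\{a_6,1\};\\ a_5 & \text{if } a=0 \text{ and } b=a_3;\\ a_2 & \text{if } (a=0 \text{ and } b\notin\{a_3,a_6,1\}) \text{ or } (a\neq 0 \text{ and } b\neq a_1);\\ a_1 & \text{if } a\neq 0 \text{ and } b=a_1;\end{cases}$$ $$a\ast b=\begin{cases}1 & \text{if } a=a_4 \text{ and } b=a_6;\\ 0&\text{otherwise};\end{cases}\qquad \Box a=\begin{cases}1&\text{if } a=a_5;\\0&\text{otherwise};\end{cases}$$ $$\Diamond a=\begin{cases}1&\text{if } a\in\{0,a_6,1\};\\ a_1&\text{if } a\in\{a_1,a_2\};\\ a_3&\text{if } a\in\{a_3,a_5\};\\ a_5&\text{if } a=a_4.\end{cases}$$ Then the variety $\mathbb{V}(\boldsymbol{A})$ generated by $\boldsymbol{A}$ has a pp expansion that is a proper quasivariety (that is, a quasivariety that is not a variety) and is not congruence preserving.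
   Context: **Implicit operations.** Let $\mathsf{K}$ be a class of algebras in a language $\mathscr{L}_{\mathsf{K}}$. An $n$-ary partial function on $\mathsf{K}$ is a sequence $f=\langle f^{\boldsymbol{A}}:\boldsymbol{A}\in\mathsf{K}\rangle$ where each $f^{\boldsymbol{A}}$ is a function from a subset $\mathsf{dom}(f^{\boldsymbol{A}})\subseteq A^n$ to $A$. A first order formula $\varphi(x_1,\dots,x_n,y)$ with $n\geq 1$ is functional in $\mathsf{K}$ when for all $\boldsymbol{A}\in\mathsf{K}$ and $a_1,\dots,a_n\in A$ there is at most one $b\in A$ with $\boldsymbol{A}\vDash\varphi(a_1,\dots,a_n,b)$; it then defines the partial function on $\mathsf{K}$ sending $\langle a_1,\dots,a_n\rangle$ to that $b$, when $b$ exists (and undefined otherwise). An implicit operation of $\mathsf{K}$ is a partial function $f$ on $\mathsf{K}$ that is defined by some formula and is preserved by homomorphisms: for each homomorphism $h\colon\boldsymbol{A}\to\boldsymbol{B}$ with $\boldsymbol{A},\boldsymbol{B}\in\mathsf{K}$ and $\langle a_1,\dots,a_n\rangle\in\mathsf{dom}(f^{\boldsymbol{A}})$ one has $\langle h(a_1),\dots,h(a_n)\rangle\in\mathsf{dom}(f^{\boldsymbol{B}})$ and $h(f^{\boldsymbol{A}}(a_1,\dots,a_n))=f^{\boldsymbol{B}}(h(a_1),\dots,h(a_n))$. It is extendable when for all $\boldsymbol{A}\in\mathsf{K}$ and $a_1,\dots,a_n\in A$ there is $\boldsymbol{B}\in\mathsf{K}$ with $\boldsymbol{A}\leq\boldsymbol{B}$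 (subalgebra) and $\langle a_1,\dots,a_n\rangle\in\mathsf{dom}(f^{\boldsymbol{B}})$. A pp formula is a formula of the form $\exists\vec z\,\psi$ with $\psi$ a finite conjunction of equations. $\mathsf{ext}_{pp}(\mathsf{K})$ is the class of extendable implicit operations of $\mathsf{K}$ that can be defined by a pp formula. **pp expansions.** For $\mathcal{F}\subseteq\mathsf{ext}_{pp}(\mathsf{K})$, let $\mathscr{L}_{\mathcal{F}}$ be obtained from $\mathscr{L}_{\mathsf{K}}$ by adding a new function symbol $g_f$ of the arity of $f$ for each $f\in\mathcal{F}$. If $\boldsymbol{A}\in\mathsf{K}$ is such that $f^{\boldsymbol{A}}$ is total for every $f\in\mathcal{F}$, then $\boldsymbol{A}[\mathscr{L}_{\mathcal{F}}]$ is the expansion of $\boldsymbol{A}$ in which each $g_f$ is interpreted as $f^{\boldsymbol{A}}$. Let $\mathsf{K}[\mathscr{L}_{\mathcal{F}}]$ be the class of all algebras $\boldsymbol{A}[\mathscr{L}_{\mathcal{F}}]$ with $\boldsymbol{A}\in\mathsf{K}$ and $f^{\boldsymbol{A}}$ total for every $f\in\mathcal{F}$. A pp expansion of $\mathsf{K}$ is a class of the form $\mathbb{S}(\mathsf{K}[\mathscr{L}_{\mathcal{F}}])$ (the subalgebras of members of $\mathsf{K}[\mathscr{L}_{\mathcal{F}}]$) for some such $\mathcal{F}$. A pp expansion of a quasivariety is a quasivariety. **Congruence preservation.** For a quasivariety $\mathsf{K}$ and an algebra $\boldsymbol{A}$ in its language, $\mathsf{Con}_{\mathsf{K}}(\boldsymbol{A})=\{\theta\in\mathsf{Con}(\boldsymbol{A}):\boldsymbol{A}/\theta\in\mathsf{K}\}$.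 A pp expansion $\mathsf{M}$ of a quasivariety $\mathsf{K}$ is congruence preserving when $\mathsf{Con}_{\mathsf{M}}(\boldsymbol{A})=\mathsf{Con}_{\mathsf{K}}(\boldsymbol{A}{\upharpoonright}_{\mathscr{L}_{\mathsf{K}}})$ for every $\boldsymbol{A}\in\mathsf{M}$, where $\boldsymbol{A}{\upharpoonright}_{\mathscr{L}_{\mathsf{K}}}$ is the $\mathscr{L}_{\mathsf{K}}$-reduct of $\boldsymbol{A}$. *)

(* Defs.v *)
From mathcomp Require Import all_boot.
From mathcomp Require Import boolp classical_sets filter.

Set Implicit Arguments.
Unset Strict Implicit.
Unset Printing Implicit Defensive.

Record language := Language { symbol : Type; arity : symbol -> nat }.

(* The universe of an algebra may be empty here; this makes no difference for
   the languages with constant symbols considered below. *)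
Record algebra (L : language) := Algebra {
  carrier :> Type;
  op : forall s : symbol L, ('I_(arity s) -> carrier) -> carrier
}.

Arguments op {L a} s x : rename.

Definition is_hom (L : language) (A B : algebra L) (h : A -> B) : Prop :=
  forall (s : symbol L) (x : 'I_(arity s) -> A),
    h (op s x) = op s (fun i => h (x i)).

(* "A is a subalgebra of B" up to identification of A with its image. *)
Definition is_embedding (L : language) (A B : algebra L) (h : A -> B) : Prop :=
  is_hom h /\ injective h.

Definition isomorphic (L : language) (A B : algebra L) : Prop :=
  exists h : A -> B, is_hom h /\ bijective h.

Definition prod_alg (L : language) (I : Type) (A : I -> algebra L) :
    algebra L :=
  @Algebra L (forall i, A i) (fun s x i => op s (fun k => x k i)).

Definition equivalence (T : Type) (theta : T -> T -> Prop) : Prop :=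
  [/\ forall a, theta a a,
      forall a b, theta a b -> theta b a
    & forall a b c, theta a b -> theta b c -> theta a c].

Definition congruence (L : language) (A : algebra L) (theta : A -> A -> Prop) :
    Prop :=
  equivalence theta /\
  forall (s : symbol L) (x y : 'I_(arity s) -> A),
    (forall i, theta (x i) (y i)) -> theta (op s x) (op s y).

(* The set of blocks a / theta = {b | theta a b}, with the operations computed
   on chosen representatives; this is the quotient algebra when theta is a
   congruence, see [class_of_hom]. *)
Section Quotient.
Variables (L : language) (A : algebra L) (theta : A -> A -> Prop).

Definition block := {S : A -> Prop | exists a, S = theta a}.

Definition class_of (a : A) : block :=
  exist _ (theta a) (ex_intro _ a erefl).

Definition repr_of (S : block) : A := projT1 (cid (proj2_sig S)).

Definition quot_alg : algebra L :=
  @Algebra L block (fun s x => class_of (op s (fun i => repr_of (x i)))).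

Lemma class_of_eq (a b : A) :
  equivalence theta -> class_of a = class_of b <-> theta a b.
Proof.
case=> rfl symm trans; split=> [/(congr1 (@proj1_sig _ _)) /= ->|ab].
  exact: rfl.
apply: eq_exist; apply/funext => c; apply/propext; split.
- by apply: trans; apply: symm.
- exact: trans.
Qed.

Lemma class_of_hom : congruence theta -> is_hom (class_of : A -> quot_alg).
Proof.
move=> [eqv cong] s x /=; apply/class_of_eq => //; apply: cong => i.
by apply/class_of_eq => //; apply: eq_exist => /=; rewrite /repr_of; case: cid.
Qed.

End Quotient.

Definition ultra_rel (L : language) (I : Type) (U : set_system I)
    (A : I -> algebra L) (x y : prod_alg A) : Prop :=
  U [set i | x i = y i]%classic.

Definition ultraprod (L : language) (I : Type) (U : set_system I)
    (A : I -> algebra L) : algebra L :=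
  quot_alg (@ultra_rel L I U A).

Definition algclass (L : language) := algebra L -> Prop.

Definition closed_I (L : language) (K : algclass L) : Prop :=
  forall A B : algebra L, K A -> isomorphic A B -> K B.

Definition closed_H (L : language) (K : algclass L) : Prop :=
  forall (A B : algebra L) (h : A -> B),
    K A -> is_hom h -> (forall b, exists a, h a = b) -> K B.

Definition closed_S (L : language) (K : algclass L) : Prop :=
  forall (A B : algebra L) (h : A -> B), K B -> is_embedding h -> K A.

Definition closed_P (L : language) (K : algclass L) : Prop :=
  forall (I : Type) (A : I -> algebra L), (forall i, K (A i)) -> K (prod_alg A).

Definition closed_PU (L : language) (K : algclass L) : Prop :=
  forall (I : Type) (U : set_system I) (A : I -> algebra L),
    UltraFilter U -> (forall i, K (A i)) -> K (ultraprod U A).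

Definition variety (L : language) (K : algclass L) : Prop :=
  [/\ closed_H K, closed_S K & closed_P K].

Definition quasivariety (L : language) (K : algclass L) : Prop :=
  [/\ closed_I K, closed_S K, closed_P K & closed_PU K].

Definition proper_quasivariety (L : language) (K : algclass L) : Prop :=
  quasivariety K /\ ~ variety K.

Definition variety_generated_by (L : language) (A : algebra L) : algclass L :=
  fun B => forall K : algclass L, variety K -> K A -> K B.

(* Terms and formulas whose free variables belong to the type V; a quantifier
   binds the additional variable [None : option V]. *)
Inductive term (L : language) (V : Type) : Type :=
| Var (v : V)
| App (s : symbol L) (t : 'I_(arity s) -> term L V).

Inductive formula (L : language) (V : Type) : Type :=
| FEq (t u : term L V)
| FTrue
| FNot (p : formula L V)
| FAnd (p q : formula L V)
| FOr (p q : formula L V)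
| FEx (p : formula L (option V))
| FAll (p : formula L (option V)).

Arguments Var {L V} v.
Arguments App {L V} s t.
Arguments FTrue {L V}.

Fixpoint eval (L : language) (A : algebra L) (V : Type) (e : V -> A)
    (t : term L V) : A :=
  match t with
  | Var v => e v
  | App s t => op s (fun i => eval e (t i))
  end.

Definition extend (V T : Type) (e : V -> T) (b : T) : option V -> T :=
  oapp e b.

Fixpoint sat (L : language) (A : algebra L) (V : Type) (p : formula L V) :
    (V -> A) -> Prop :=
  match p with
  | FEq t u => fun e => eval e t = eval e u
  | FTrue => fun=> True
  | FNot p => fun e => ~ sat p e
  | FAnd p q => fun e => sat p e /\ sat q e
  | FOr p q => fun e => sat p e \/ sat q e
  | FEx p => fun e => exists b : A, sat p (extend e b)
  | FAll p => fun e => forall b : A, sat p (extend e b)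
  end.

Inductive conj_of_eqs (L : language) (V : Type) : formula L V -> Prop :=
| Conj_true : conj_of_eqs FTrue
| Conj_eq (t u : term L V) : conj_of_eqs (FEq t u)
| Conj_and (p q : formula L V) :
    conj_of_eqs p -> conj_of_eqs q -> conj_of_eqs (FAnd p q).

Inductive pp_formula (L : language) : forall V : Type, formula L V -> Prop :=
| PP_conj (V : Type) (p : formula L V) : conj_of_eqs p -> pp_formula p
| PP_ex (V : Type) (p : formula L (option V)) :
    pp_formula p -> pp_formula (FEx p).

Section ImplicitOperations.
Variables (L : language) (K : algclass L).

(* [pf_fun f KA a = None] means that the tuple a is not in dom(f^A). *)
Record pfun := PFun {
  pf_arity : nat;
  pf_fun : forall A : algebra L, K A -> ('I_pf_arity -> A) -> option A
}.

(* The variables x_1, ..., x_n, y are the elements of option 'I_n, with y being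
   [None]. The equivalence makes phi functional in K. *)
Definition defines (f : pfun) (phi : formula L (option 'I_(pf_arity f))) :
    Prop :=
  forall (A : algebra L) (KA : K A) (a : 'I_(pf_arity f) -> A) (b : A),
    pf_fun KA a = Some b <-> sat phi (extend a b).

Definition preserved_by_homs (f : pfun) : Prop :=
  forall (A B : algebra L) (KA : K A) (KB : K B) (h : A -> B), is_hom h ->
  forall (a : 'I_(pf_arity f) -> A) (b : A),
    pf_fun KA a = Some b -> pf_fun KB (fun i => h (a i)) = Some (h b).

Definition implicit_operation (f : pfun) : Prop :=
  [/\ (0 < pf_arity f)%N,
      exists phi : formula L (option 'I_(pf_arity f)), defines phi
    & preserved_by_homs f].

Definition extendable (f : pfun) : Prop :=
  forall (A : algebra L), K A -> forall a : 'I_(pf_arity f) -> A,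
  exists (B : algebra L) (KB : K B) (h : A -> B) (b : B),
    is_embedding h /\ pf_fun KB (fun i => h (a i)) = Some b.

Definition ext_pp (f : pfun) : Prop :=
  [/\ implicit_operation f, extendable f
    & exists phi : formula L (option 'I_(pf_arity f)),
        pp_formula phi /\ defines phi].

Variable F : pfun -> Prop.

Definition expanded_language : language :=
  @Language (symbol L + {f : pfun | F f})
    (fun s => match s with
              | inl s => arity s
              | inr g => pf_arity (proj1_sig g)
              end).

Definition reduct (A : algebra expanded_language) : algebra L :=
  @Algebra L A (fun s x => @op _ A (inl s) x).

(* The class K[L_F]: B is A[L_F] for its reduct A, which belongs to K and on
   which every f in F is total with graph the interpretation of g_f. *)
Definition expanded_class : algclass expanded_language := fun B =>
  exists KA : K (reduct B),
  forall (g : {f : pfun | F f}) (x : 'I_(pf_arity (proj1_sig g)) -> reduct B),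
    pf_fun KA x = Some (@op _ B (inr g) x).

(* S(K[L_F]); it is a pp expansion of K when F is a subset of ext_pp K. *)
Definition pp_expansion : algclass expanded_language := fun A =>
  exists (B : algebra expanded_language) (h : A -> B),
    expanded_class B /\ is_embedding h.

Definition Con (L' : language) (K' : algclass L') (A : algebra L')
    (theta : A -> A -> Prop) : Prop :=
  congruence theta /\ K' (quot_alg theta).

Definition congruence_preserving : Prop :=
  forall A : algebra expanded_language, pp_expansion A ->
  forall theta : A -> A -> Prop,
    Con pp_expansion theta <-> @Con L K (reduct A) theta.

End ImplicitOperations.

Arguments pp_expansion {L K} F A.

Inductive A8 := e0 | a1 | a2 | a3 | a4 | a5 | a6 | e1.

Definition rank (a : A8) : nat :=
  match a with
  | e0 => 0 | a1 => 1 | a2 => 2 | a3 => 3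
  | a4 => 4 | a5 => 5 | a6 => 6 | e1 => 7
  end.

Definition A8_le (a b : A8) : bool := (rank a <= rank b)%N.

Definition A8_meet (a b : A8) : A8 := if A8_le a b then a else b.
Definition A8_join (a b : A8) : A8 := if A8_le a b then b else a.
Definition A8_imp (a b : A8) : A8 := if A8_le a b then e1 else b.

Lemma A8_imp_residual (a b c : A8) :
  A8_le (A8_meet a c) b = A8_le c (A8_imp a b).
Proof. by case: a; case: b; case: c. Qed.

Definition A8_plus (a b : A8) : A8 :=
  match a, b with
  | e0, (a6 | e1) => a6
  | e0, a3 => a5
  | e0, _ => a2
  | _, a1 => a1
  | _, _ => a2
  end.

Definition A8_ast (a b : A8) : A8 :=
  match a, b with
  | a4, a6 => e1
  | _, _ => e0
  end.

Definition A8_box (a : A8) : A8 :=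
  match a with
  | a5 => e1
  | _ => e0
  end.

Definition A8_dia (a : A8) : A8 :=
  match a with
  | e0 | a6 | e1 => e1
  | a1 | a2 => a1
  | a3 | a5 => a3
  | a4 => a5
  end.

Inductive symb :=
  SMeet | SJoin | SImp | SZero | SOne | SConst | SPlus | SAst | SBox | SDia.

Definition symb_arity (s : symb) : nat :=
  match s with
  | SZero | SOne | SConst => 0
  | SBox | SDia => 1
  | SMeet | SJoin | SImp | SPlus | SAst => 2
  end.

Definition LA : language := Language symb_arity.

Definition algA_op (s : symb) : ('I_(symb_arity s) -> A8) -> A8 :=
  match s with
  | SMeet => fun x => A8_meet (x ord0) (x ord_max)
  | SJoin => fun x => A8_join (x ord0) (x ord_max)
  | SImp => fun x => A8_imp (x ord0) (x ord_max)
  | SZero => fun=> e0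
  | SOne => fun=> e1
  | SConst => fun=> a5
  | SPlus => fun x => A8_plus (x ord0) (x ord_max)
  | SAst => fun x => A8_ast (x ord0) (x ord_max)
  | SBox => fun x => A8_box (x ord0)
  | SDia => fun x => A8_dia (x ord0)
  end.

Definition algA : algebra LA := @Algebra LA A8 algA_op.

(* Main.v *)
(* Let B be the subalgebra A \ {a4} and C the quotient of B that identifies a6
   with 1. The term test4 z = a6 \/ (z * a6), where a6 = 0 + 1, is 1 in A only
   at z = a4, and it is constantly 1 in C. Hence the formula
   "exists z, test4 z = 1 and y = Box (Diamond z)" defines the constant 1 on A
   and the constant 0 on C. It is functional on V(A) by equational reasoning,
   and extendable because V(A) is contained in SP(A, C), which is shown by
   Jonsson's ultrafilter argument. In the resulting expansion, B is a subalgebra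
   of A with the new operation constantly 1; its quotient C inherits the
   constant 1 instead of 0, so it lies outside of the pp expansion. *)
From mathcomp Require Import all_boot.
From mathcomp Require Import boolp classical_sets filter.
Require Import Defs.

Set Implicit Arguments.
Unset Strict Implicit.
Unset Printing Implicit Defensive.

Local Notation V8 := (variety_generated_by algA).

(** * Identities in generated varieties, and ultraproducts of embeddings *)

Section GeneralAlgebra.
Variable L : language.

Lemma eval_hom (A B : algebra L) (h : A -> B) (V : Type) (e : V -> A)
    (t : term L V) :
  is_hom h -> h (eval e t) = eval (fun v => h (e v)) t.
Proof.
move=> hh; elim: t => [//|s t IH] /=.
by rewrite hh; congr op; apply/funext => i.
Qed.

Lemma is_hom_comp (A B C : algebra L) (h : A -> B) (k : B -> C) :
  is_hom h -> is_hom k -> is_hom (k \o h).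
Proof. by move=> hh kk s x; rewrite /= hh kk. Qed.

Lemma variety_generated_variety (A : algebra L) :
  variety (variety_generated_by A).
Proof.
split=> [B C h KB hh sh K VK KA|B C h KC hh K VK KA|I B KB K VK KA].
- by have [HK _ _] := VK; exact: HK (KB K VK KA) hh sh.
- by have [_ SK _] := VK; exact: SK (KC K VK KA) hh.
- by have [_ _ PK] := VK; apply: PK => i; exact: KB.
Qed.

Lemma variety_generated_mem (A : algebra L) : variety_generated_by A A.
Proof. by []. Qed.

(** The algebras that satisfy a fixed identity form a variety, so an identity of [A] passes to
    everything that [A] generates. *)
Lemma variety_generated_law (A : algebra L) (V : Type) (t u : term L V) :
  (forall e : V -> A, eval e t = eval e u) ->
  forall B : algebra L, variety_generated_by A B ->
  forall e : V -> B, eval e t = eval e u.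
Proof.
move=> tu B /(_ (fun C => forall e : V -> C, eval e t = eval e u)); apply=> //.
split=> [C D h KC hh sh e|C D h KD [hh ih] e|I C KC e].
- pose e' v := projT1 (cid (sh (e v))).
  have -> : e = fun v => h (e' v).
    by apply/funext => v; rewrite /e'; case: cid.
  by rewrite -!(eval_hom _ _ hh) KC.
- by apply: ih; rewrite !(eval_hom _ _ hh) KD.
- apply: functional_extensionality_dep => i.
  have pr : @is_hom L (prod_alg C) (C i) (fun x => x i) by [].
  by rewrite (eval_hom _ _ pr) (eval_hom e u pr) KC.
Qed.

Lemma class_of_repr (A : algebra L) (theta : A -> A -> Prop)
    (S : block theta) : class_of theta (repr_of S) = S.
Proof.
by case: S => S HS; apply: eq_exist; rewrite /repr_of; case: cid => a /= ->.
Qed.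

Lemma ultra_rel_congruence (I : Type) (U : set_system I) (A : I -> algebra L) :
  Filter U -> congruence (@ultra_rel L I U A).
Proof.
move=> FU; split.
- split=> [a|a b|a b c]; rewrite /ultra_rel.
  + by apply: filterS filterT.
  + by apply: filterS.
  + move=> ab bc; apply: filterS (filterI ab bc) => i [/= -> ->]; done.
- move=> s x y xy; rewrite /ultra_rel.
  by apply: filterS (filter_forall FU xy) => i /= xyi; congr op; apply/funext.
Qed.

(** Each [h i] is injective, so two families agree at exactly the same indices as their images;
    hence the coordinatewise map is well defined and injective on classes. *)
Lemma ultraprod_embedding (I : Type) (U : set_system I)
    (A B : I -> algebra L) (h : forall i, A i -> B i) :
  Filter U -> (forall i, is_embedding (h i)) ->
  exists k : ultraprod U A -> ultraprod U B, is_embedding k.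
Proof.
move=> FU hh.
have cA := ultra_rel_congruence A FU; have cB := ultra_rel_congruence B FU.
pose H (x : prod_alg A) : prod_alg B := fun i => h i (x i).
have HE x y : ultra_rel U (H x) (H y) <-> ultra_rel U x y.
  split; apply: filterS => i /= E; last by rewrite /H E.
  by have [_] := hh i; exact.
pose k (S : ultraprod U A) : ultraprod U B := class_of _ (H (repr_of S)).
have kE x : k (class_of _ x) = class_of _ (H x).
  apply/(class_of_eq _ _ cB.1)/HE/(class_of_eq _ _ cA.1).
  exact: class_of_repr.
have Hh : is_hom H.
  move=> s x; apply: functional_extensionality_dep => i.
  by have [hi _] := hh i; rewrite /H /= hi.
exists k; split=> [s x|S S'].
- rewrite [op s x]/= kE Hh (class_of_hom cB) /=; congr class_of.
- rewrite -[S]class_of_repr -[S']class_of_repr !kE.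
  by move=> /(class_of_eq _ _ cB.1)/HE/(class_of_eq _ _ cA.1).
Qed.

End GeneralAlgebra.

(** * Terms over the language of A, and their values *)

Section Terms.
Variable V : Type.
Implicit Types t u : term LA V.

Definition no_args (T : Type) (i : 'I_0) : T :=
  match notF (ltn_ord i) with end.

Definition two_args (n : nat) (T : Type) (x y : T) (i : 'I_n) : T :=
  if nat_of_ord i is 0 then x else y.

(* For a unary symbol [s] only the first argument matters. *)
Definition T2 (s : symbol LA) t u : term LA V := App s (two_args t u).

Definition tzero : term LA V := @App LA V SZero (no_args _).
Definition tone : term LA V := @App LA V SOne (no_args _).
Definition tfive : term LA V := @App LA V SConst (no_args _).
Definition tsix : term LA V := T2 SPlus tzero tone.
(** In A only a4 has Diamond value a5, and Box is 1 only at a5; so this term is 1 at a4 and 0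
    elsewhere. *)
Definition tbd t : term LA V := let d := T2 SDia t t in T2 SBox d d.
Definition tiff t u : term LA V := T2 SMeet (T2 SImp t u) (T2 SImp u t).

Definition test4 t : term LA V := T2 SJoin tsix (T2 SAst t tsix).

End Terms.

Arguments tzero {V}.
Arguments tone {V}.
Arguments tfive {V}.
Arguments tsix {V}.

Section Op2.
Variable D : algebra LA.

Definition op2 (s : symbol LA) (x y : D) : D := op s (two_args x y).

Definition one_of : D := @op LA D SOne (no_args D).
Definition six_of : D := @eval LA D D id tsix.
Definition five_of : D := @eval LA D D id tfive.
Definition zero_of : D := @eval LA D D id tzero.

Lemma evalT2 (V : Type) (e : V -> D) s (t u : term LA V) :
  eval e (T2 s t u) = op2 s (eval e t) (eval e u).
Proof.
by congr op; apply/funext => i; rewrite /two_args; case: (nat_of_ord i).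
Qed.

Lemma eq_no_args (T R : Type) (f : ('I_0 -> T) -> R) (x y : 'I_0 -> T) :
  f x = f y.
Proof. by congr f; apply/funext => -[]. Qed.

Lemma eval_one (V : Type) (e : V -> D) : eval e tone = one_of.
Proof. exact: (eq_no_args (@op LA D SOne)). Qed.

Lemma eval_zero (V : Type) (e : V -> D) : eval e tzero = zero_of.
Proof. exact: (eq_no_args (@op LA D SZero)). Qed.

Lemma eval_five (V : Type) (e : V -> D) : eval e tfive = five_of.
Proof. exact: (eq_no_args (@op LA D SConst)). Qed.

Lemma eval_six (V : Type) (e : V -> D) : eval e tsix = six_of.
Proof. by rewrite /six_of !evalT2 !eval_one !eval_zero. Qed.

Definition bd (x : D) : D := let d := op2 SDia x x in op2 SBox d d.
Definition iff2 (x y : D) : D := op2 SMeet (op2 SImp x y) (op2 SImp y x).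
Definition test4_of (x : D) : D := op2 SJoin six_of (op2 SAst x six_of).

Definition evalE := (evalT2, eval_one, eval_zero, eval_five, eval_six).

Lemma eval_bd (V : Type) (e : V -> D) t : eval e (tbd t) = bd (eval e t).
Proof. by rewrite /tbd !evalE. Qed.

Lemma eval_iff (V : Type) (e : V -> D) t u :
  eval e (tiff t u) = iff2 (eval e t) (eval e u).
Proof. by rewrite /tiff !evalE. Qed.

Lemma eval_test4 (V : Type) (e : V -> D) t :
  eval e (test4 t) = test4_of (eval e t).
Proof. by rewrite /test4 !evalE. Qed.

End Op2.

Section HomOps.
Variables (D E : algebra LA) (h : D -> E).
Hypothesis hh : is_hom h.

Lemma hom_one : h (one_of D) = one_of E.
Proof. by rewrite -(eval_one id) (eval_hom _ _ hh) eval_one. Qed.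

Lemma hom_bd x : h (bd x) = bd (h x).
Proof. by rewrite -(eval_bd id (Var x)) (eval_hom _ _ hh) eval_bd. Qed.

Lemma hom_test4 x : h (test4_of x) = test4_of (h x).
Proof. by rewrite -(eval_test4 id (Var x)) (eval_hom _ _ hh) eval_test4. Qed.

End HomOps.
Definition evals (D : algebra LA) :=
  (@eval_six D, @eval_bd D, @eval_iff D, @eval_test4 D, @evalE D).

(** * Identities of V(A), each verified on the tables of A *)

Section Laws.
Variables (D : algebra LA) (KD : V8 D).
Implicit Types p w x y z : D.

(** The elements of [D] serve as variables and denote themselves under [id], so identities of A
    become equalities between elements of [D]. *)
Lemma law (t u : term LA D) :
  (forall e : D -> algA, eval e t = eval e u) -> eval id t = eval id u.
Proof. by move=> tu; exact: (variety_generated_law tu KD). Qed.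

(** In A, both sides are 1 if z = a4; otherwise [test4_of z] is a6, and z' * a6 = [bd z']. *)
Lemma bd_join_test4 z z' :
  op2 SJoin (bd z) (op2 SAst z' (test4_of z)) = op2 SJoin (bd z) (bd z').
Proof.
have := @law (T2 SJoin (tbd (Var z)) (T2 SAst (Var z') (test4 (Var z))))
  (T2 SJoin (tbd (Var z)) (tbd (Var z'))).
by rewrite !evals; apply=> e /=; case: (e z); case: (e z').
Qed.

Lemma bd_joinC z z' : op2 SJoin (bd z) (bd z') = op2 SJoin (bd z') (bd z).
Proof.
have := @law (T2 SJoin (tbd (Var z)) (tbd (Var z')))
  (T2 SJoin (tbd (Var z')) (tbd (Var z))).
by rewrite !evals; apply=> e /=; case: (e z); case: (e z').
Qed.

Lemma ast1_join w p : op2 SJoin (op2 SAst w (one_of D)) p = p.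
Proof.
have := @law (T2 SJoin (T2 SAst (Var w) tone) (Var p)) (Var p).
by rewrite !evals; apply=> e /=; case: (e w); case: (e p).
Qed.

Lemma join_ast1 w p : op2 SJoin p (op2 SAst w (one_of D)) = p.
Proof.
have := @law (T2 SJoin (Var p) (T2 SAst (Var w) tone)) (Var p).
by rewrite !evals; apply=> e /=; case: (e w); case: (e p).
Qed.

Lemma joinxx p : op2 SJoin p p = p.
Proof.
have := @law (T2 SJoin (Var p) (Var p)) (Var p).
by rewrite !evals; apply=> e /=; case: (e p).
Qed.

Lemma iffxx p : iff2 p p = one_of D.
Proof.
have := @law (tiff (Var p) (Var p)) tone.
by rewrite !evals; apply=> e /=; case: (e p).
Qed.

Lemma join1x p : op2 SJoin (one_of D) p = one_of D.
Proof.
have := @law (T2 SJoin tone (Var p)) tone.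
by rewrite !evals; apply=> e /=; case: (e p).
Qed.

Lemma imp1x p : op2 SImp (one_of D) p = p.
Proof.
have := @law (T2 SImp tone (Var p)) (Var p).
by rewrite !evals; apply=> e /=; case: (e p).
Qed.

Lemma box1_join p : op2 SJoin (op2 SBox (one_of D) (one_of D)) p = p.
Proof.
have := @law (T2 SJoin (T2 SBox tone tone) (Var p)) (Var p).
by rewrite !evals; apply=> e /=; case: (e p).
Qed.

Lemma iff_eq1 x y : iff2 x y = one_of D -> x = y.
Proof.
have := @law (T2 SMeet (Var x) (tiff (Var x) (Var y)))
  (T2 SMeet (Var y) (tiff (Var x) (Var y))).
have meetx1 z : op2 SMeet z (one_of D) = z.
  have := @law (T2 SMeet (Var z) tone) (Var z).
  by rewrite !evals; apply=> e /=; case: (e z).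
rewrite !evals /= => E xy1; rewrite xy1 !meetx1 in E; apply: E => e /=.
by case: (e x); case: (e y).
Qed.

(** As z' * 1 = 0, the identity [bd_join_test4] at [test4_of z] = 1 gives [bd z] = [bd z] \/
    [bd z'], which is symmetric in z and z'. *)
Lemma bd_unique z z' :
  test4_of z = one_of D -> test4_of z' = one_of D -> bd z = bd z'.
Proof.
move=> z1 z'1; rewrite -(join_ast1 z' (bd z)) -z1 bd_join_test4 bd_joinC.
by rewrite -bd_join_test4 z'1 join_ast1.
Qed.

End Laws.

(** * Assignments into A under which no term denoting [p] takes the value 1 *)

Section Separation.
Variables (D : algebra LA) (KD : V8 D) (p : D).
Hypothesis p1 : p <> one_of D.
Implicit Types t u w : term LA D.

Notation phi := (@eval LA D D id).

Definition avoids (e : D -> algA) := forall t, phi t = p -> eval e t <> e1.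

(* Jonsson's argument: the sets of assignments on which some term denoting [p]
   is constantly 1 are closed under finite unions, because [p \/ p = p]. *)
Lemma exists_avoiding : exists e, avoids e.
Proof.
pose G (X : set (D -> algA)) :=
  exists2 t, phi t = p & forall e : D -> algA, eval e t <> e1 :> A8 -> X e.
have PG : ProperFilter G.
  split.
    move=> [t tp t1]; apply: p1; rewrite -tp -(eval_one id).
    by apply: law => // e; apply: contrapT => /t1.
  split.
  - by exists (Var p).
  - move=> X Y [t tp tX] [u up uY]; exists (T2 SJoin t u).
      by rewrite !evals tp up joinxx.
    move=> e; rewrite !evals => tu; split; [apply: tX|apply: uY] => E.
      by apply: tu; rewrite E; case: (eval _ u).
    by apply: tu; rewrite E; case: (eval _ t).
  - by move=> X Y XY [t tp tX]; exists t => // e /tX/XY.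
have [U [UU GU]] := ultraFilterLemma PG.
have FU : Filter U by exact: filter_filter.
(* A has only eight elements: if no fibre of evaluation at x were in [U], the finite intersection of
   their complements, which is empty, would be. *)
have lim x : exists a : A8, U [set e : D -> algA | e x = a]%classic.
  apply: contrapT => no.
  have nU a : U (~` [set e : D -> algA | e x = a])%classic.
    by case: (in_ultra_setVsetC [set e : D -> algA | e x = a]%classic UU)
      => // Ua; case: no; exists a.
  have Uall : U [set e : D -> algA |
      forall i : 'I_8,
        e x <> nth e0 [:: e0; a1; a2; a3; a4; a5; a6; e1] i]%classic.
    by apply: filter_forall => i; exact: nU.
  apply: (@filter_not_empty _ U _); apply: filterS Uall => e /= ne.
  have e8 : rank (e x) < 8 by case: (e x).
  by have := ne (Ordinal e8) => /=; case: (e x).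
pose e x : algA := projT1 (cid (lim x)).
(* Operations are finitary, so the limit along [U] commutes with the evaluation of terms. *)
have Ue (t : term LA D) : U [set e' : D -> algA | eval e' t = eval e t]%classic.
  elim: t => [x|s t IH] /=; first by rewrite /e; case: cid.
  apply: filterS (filter_forall FU IH) => e' /= E.
  by congr algA_op; apply/funext.
exists e => t tp t1.
apply: (@filter_not_empty _ U _).
have Ut : U [set e' : D -> algA | eval e' t <> e1]%classic.
  by apply: GU; exists t.
by apply: filterS (filterI (Ue t) Ut) => e' [/= -> /(_ t1)].
Qed.


Variable e : D -> algA.
Hypothesis av : avoids e.
Notation ev t := (@eval LA algA D e t : A8).

(** The term Box(t \/ a5) \/ p denotes Box 1 \/ p = p, yet its value would be Box a5 = 1 if t had a
    value at most a5. *)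
Lemma avoids_ge_a6 t : phi t = one_of D -> (a6 = ev t) \/ (e1 = ev t).
Proof.
move=> t1; pose t5 := T2 SJoin t tfive.
have := av (t := T2 SJoin (T2 SBox t5 t5) (Var p)).
rewrite !evals /= t1 join1x // box1_join // => /(_ erefl).
by case: (eval e t) => H; first [by left|by right|by case: H; case: (e p)].
Qed.

(** The term (w * t) \/ p denotes (w * 1) \/ p = p, while a4 * a6 = 1. *)
Lemma avoids_no_a4 t w : phi t = one_of D -> ev t = a6 -> ev w <> a4.
Proof.
move=> t1 t6 w4; have := av (t := T2 SJoin (T2 SAst w t) (Var p)).
by rewrite !evals /= t1 ast1_join // t6 w4 => /(_ erefl); apply; case: (e p).
Qed.

(** The term t -> u denotes 1 -> p = p, while a6 -> a6 = 1. *)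
Lemma avoids_neq_a6 t u : phi t = one_of D -> ev t = a6 -> phi u = p ->
  ev u <> a6.
Proof.
move=> t1 t6 up u6; have := av (t := T2 SImp t u).
by rewrite !evals t1 up imp1x // t6 u6 => /(_ erefl).
Qed.

End Separation.

(** * The subalgebra B of A and its quotient C *)

Definition not4 (a : A8) : bool := if a is a4 then false else true.

Definition collapse (a : A8) : A8 := if a is a6 then e1 else a.

Lemma not4_op (s : symbol LA) (x : 'I_(arity s) -> algA) :
  (forall i, not4 (x i)) -> not4 (op s x).
Proof.
by case: s x => x h //=; have := h ord0; try have := h ord_max;
  case: (x ord0) => //; case: (x ord_max).
Qed.

(** In A the identification of a6 with 1 fails because a4 * a6 = 1 and a4 * 1 = 0. Without a4 the
    operation * is constantly 0, and the others respect the identification. *)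
Lemma collapse_op (s : symbol LA) (x : 'I_(arity s) -> algA) :
  (forall i, not4 (x i)) ->
  collapse (op s x) = collapse (op (a := algA) s (fun i => collapse (x i))).
Proof.
by case: s x => x h //=; have := h ord0; try have := h ord_max;
  case: (x ord0) => //; case: (x ord_max).
Qed.

Definition B7 := {a : A8 | not4 a}.

Definition algB : algebra LA :=
  @Algebra LA B7 (fun s x =>
    exist (fun a : A8 => not4 a) _
      (@not4_op s (fun i => sval (x i)) (fun i => svalP (x i)))).

Definition theta (a b : B7) : Prop := collapse (sval a) = collapse (sval b).

Lemma theta_equivalence : equivalence theta.
Proof. by split=> [|a b|a b c]; rewrite /theta => // ->. Qed.

Lemma theta_congruence : @congruence LA algB theta.
Proof.
split; first exact: theta_equivalence.
move=> s x y xy; rewrite /theta /=.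
rewrite (collapse_op (fun i => svalP (x i))).
rewrite (collapse_op (fun i => svalP (y i))).
by congr collapse; congr algA_op; apply/funext.
Qed.

Lemma algB_variety : V8 algB.
Proof.
have [_ SV _] := variety_generated_variety algA.
apply: (SV algB algA sval); first exact: variety_generated_mem.
by split=> // -[a ha] [b hb] /= ab; exact: eq_exist.
Qed.

Lemma algC_variety : V8 (@quot_alg LA algB theta).
Proof.
have [HV _ _] := variety_generated_variety algA.
apply: HV algB_variety (class_of_hom theta_congruence) _ => S.
by exists (repr_of S); exact: class_of_repr.
Qed.

(** * Extendability and the pp definable operation *)

(** An assignment [e] that avoids the value 1 for the element [iff2 d d'] induces a homomorphism
    into C or into A, according to whether some term denoting 1 gets the value a6. *)
Lemma separation (D : algebra LA) (d d' : D) : V8 D -> d <> d' ->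
  exists (R : algebra LA) (h : D -> R) (z : R),
    [/\ V8 R, is_hom h, test4_of z = one_of R & h d <> h d'].
Proof.
move=> KD dd'; have p1 : iff2 d d' <> one_of D by move=> /(iff_eq1 KD).
have [e av] := exists_avoiding KD p1.
have pE : eval id (tiff (Var d) (Var d')) = iff2 d d' by rewrite eval_iff.
case: (pselect (exists2 t : term LA D, eval id t = one_of D &
  eval e t = a6 :> A8)).
- move=> [t t1 t6].
  have n4 u : not4 (eval e u).
    by have := avoids_no_a4 KD av (w := u) t1 t6; case: (eval e u).
  (* The term [tiff u v] denotes 1, so its value is a6 or 1; the values of u and v are then equal,
     or they are a6 and 1. *)
  have eqv (u v : term LA D) : eval id u = eval id v ->
      collapse (eval e u) = collapse (eval e v).
    move=> uv; have := avoids_ge_a6 KD av (t := tiff u v).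
    rewrite !evals uv iffxx // => /(_ erefl).
    by case: (eval e u); case: (eval e v) => // -[].
  pose k x : algB := exist (fun a : A8 => not4 a) (e x) (n4 (Var x)).
  exists (@quot_alg LA algB theta), (fun x => @class_of LA algB theta (k x)),
    (@class_of LA algB theta (k d)).
  split.
  + exact: algC_variety.
  + move=> s x; rewrite -(class_of_hom theta_congruence).
    apply/(@class_of_eq LA algB _ _ _ theta_equivalence).
    exact: (eqv (Var (op s x)) (App s (fun i => Var (x i)))).
  + rewrite -(hom_test4 (class_of_hom theta_congruence)).
    rewrite -(hom_one (class_of_hom theta_congruence)).
    apply/(@class_of_eq LA algB _ _ _ theta_equivalence).
    by rewrite /theta /=; case: (e d).
  + move=> /(@class_of_eq LA algB _ _ _ theta_equivalence).
    rewrite /theta /= => E.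
    (* The value of [tiff] at d and d' is neither 1 nor a6, whereas equal collapses would force one
       of these. *)
    have := av _ pE; have := avoids_neq_a6 KD av t1 t6 pE.
    rewrite !evals /=; move: E.
    by case: (e d); case: (e d').
(* Now every term denoting 1 has the value 1, so [e] itself is a homomorphism into A, where a4
   passes the test. *)
- move=> no.
  have eqv (u v : term LA D) : eval id u = eval id v ->
      eval e u = eval e v.
    move=> uv; have := avoids_ge_a6 KD av (t := tiff u v).
    have iff1 : eval id (tiff u v) = one_of D by rewrite !evals uv iffxx.
    move=> /(_ iff1) [E|]; first by case: no; exists (tiff u v).
    by rewrite !evals; case: (eval e u); case: (eval e v).
  exists algA, e, a4; split => //.
  + move=> s x; exact: (eqv (Var (op s x)) (App s (fun i => Var (x i)))).
  + by move=> E; apply: (av _ pE); rewrite !evals /= E; case: (e d').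
Qed.

(** Take the product of the separating algebras over all pairs of distinct elements; the witnesses
    form a single tuple, which passes the test coordinatewise. *)
Lemma variety_embedding (D : algebra LA) : V8 D ->
  exists (E : algebra LA) (h : D -> E) (z : E),
    [/\ V8 E, is_embedding h & test4_of z = one_of E].
Proof.
move=> KD; pose I := {u : D * D | u.1 <> u.2}.
have sR (u : I) := cid (separation KD (svalP u)); pose R u := projT1 (sR u).
have sh u := cid (projT2 (sR u)); pose h u : D -> R u := projT1 (sh u).
have sz u := cid (projT2 (sh u)); pose z u : R u := projT1 (sz u).
have H u : [/\ V8 (R u), is_hom (h u), test4_of (z u) = one_of (R u)
  & h u (sval u).1 <> h u (sval u).2] := projT2 (sz u).
pose k x : prod_alg R := fun u => h u x.
exists (prod_alg R), k, z; split.
- have [_ _ PV] := variety_generated_variety algA.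
  by apply: PV => u; have [] := H u.
- split=> [s x|x y xy].
    apply: functional_extensionality_dep => u.
    by have [_ hu _ _] := H u; exact: hu.
  apply: contrapT => nxy; have [_ _ _] := H (exist _ (x, y) nxy).
  by apply; exact: (congr1 (fun w => w _) xy).
- apply: functional_extensionality_dep => u; have [_ _ E _] := H u.
  have pr : @is_hom LA (prod_alg R) (R u) (fun w => w u) by [].
  by rewrite (hom_test4 pr) (hom_one pr).
Qed.

(* The variable y is [Some None] and z is [None]. *)
Definition bd_formula : formula LA (option 'I_1) :=
  FEx (FAnd (FEq (test4 (Var None)) tone)
            (FEq (Var (Some None)) (tbd (Var None)))).

Lemma sat_bd_formula (D : algebra LA) (a : 'I_1 -> D) (b : D) :
  sat bd_formula (extend a b) <->
  exists2 z : D, test4_of z = one_of D & b = bd z.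
Proof.
have E (z : D) (e := extend (extend a b) z) :
    sat (FAnd (FEq (test4 (Var None)) tone)
          (FEq (Var (Some None)) (tbd (Var None)))) e <->
    test4_of z = one_of D /\ b = bd z.
  have := eval_bd e (Var None); have := eval_test4 e (Var None).
  by move=> /= <- <-; rewrite -(eval_one e).
by split=> -[z]; [move=> /E[]; exists z | move=> z1 bz; exists z; apply/E].
Qed.

(** Implicit operations have positive arity, so this constant is given one dummy argument. *)
Definition bd_op : pfun V8 :=
  @PFun LA V8 1 (fun D _ a =>
    if pselect (exists b, sat bd_formula (extend a b)) is left ex
    then Some (projT1 (cid ex)) else None).

Lemma bd_opP (D : algebra LA) (KD : V8 D) (a : 'I_1 -> D) (b : D) :
  pf_fun (p := bd_op) KD a = Some b <->
  exists2 z : D, test4_of z = one_of D & b = bd z.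
Proof.
rewrite -(sat_bd_formula a) /pf_fun /bd_op.
case: pselect => [ex|nex]; last first.
  by split=> // sb; case: nex; exists b.
case: cid => c sc; split=> [[<-] //|sb]; rewrite [projT1 _]/=; congr Some.
move: sc sb => /sat_bd_formula[z z1 ->] /sat_bd_formula[z' z'1 ->].
exact: bd_unique.
Qed.

Lemma defines_bd_op : @defines LA V8 bd_op bd_formula.
Proof. by move=> D KD a b; rewrite bd_opP sat_bd_formula. Qed.

Lemma preserved_bd_op : preserved_by_homs bd_op.
Proof.
move=> D E KD KE h hh a b /bd_opP[z z1 ->]; apply/bd_opP; exists (h z).
  by rewrite -(hom_test4 hh) z1 (hom_one hh).
exact: hom_bd.
Qed.

Lemma ext_pp_bd_op : ext_pp bd_op.
Proof.
split.
- split=> //; last exact: preserved_bd_op.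
  by exists bd_formula; exact: defines_bd_op.
- move=> D KD a; have [E [h [z [KE hh z1]]]] := variety_embedding KD.
  by exists E, KE, h, (bd z); split=> //; apply/bd_opP; exists z.
- exists bd_formula; split; last exact: defines_bd_op.
  by apply/PP_ex/PP_conj/Conj_and; exact: Conj_eq.
Qed.

(** * A pp expansion of a variety is a quasivariety *)

Section PPExpansion.
Variables (L : language) (K : algclass L) (F : pfun K -> Prop).
Hypotheses (VK : variety K) (FK : forall f, F f -> ext_pp f).

(** Arguments lift along the surjection, and the operations in [F] are preserved by homomorphisms;
    totality and values thus carry over to the image. *)
Lemma expanded_class_H : closed_H (@expanded_class L K F).
Proof.
move=> A B h [KA fA] hh sh.
have hr : @is_hom L (reduct A) (reduct B) h by move=> s x; exact: (hh (inl s)).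
have KB : K (reduct B) by have [HK _ _] := VK; exact: HK KA hr sh.
exists KB => g y.
pose x i := projT1 (cid (sh (y i))).
have -> : y = fun i => h (x i).
  by apply/funext => i; rewrite /x; case: cid.
have [[_ _ hf] _ _] := FK (svalP g).
by rewrite (hf _ _ KA KB h hr _ _ (fA g x)) (hh (inr g)).
Qed.

Lemma sat_conj_prod (I : Type) (A : I -> algebra L) (V : Type)
    (p : formula L V) (e : V -> prod_alg A) :
  conj_of_eqs p ->
  sat p e <-> forall i, sat p (fun v => e v i).
Proof.
have ev (t : term L V) i : eval e t i = eval (fun v => e v i) t.
  have pr : @is_hom L (prod_alg A) (A i) (fun x => x i) by [].
  exact: (eval_hom e t pr).
elim=> [|t u|q r _ IHq _ IHr] //=.
- split=> [tu i|tu]; first by rewrite -!ev tu.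
  by apply: functional_extensionality_dep => i; rewrite !ev.
- rewrite IHq IHr; split=> [[Hq Hr] i|H]; first by split.
  by split=> i; have [] := H i.
Qed.

(** Existential witnesses are chosen coordinatewise. *)
Lemma sat_pp_prod (I : Type) (A : I -> algebra L) (V : Type)
    (p : formula L V) : pp_formula p -> forall e : V -> prod_alg A,
  (forall i, sat p (fun v => e v i)) -> sat p e.
Proof.
elim=> [W q cq e|W q _ IH e] H; first exact/sat_conj_prod.
pose b : prod_alg A := fun i => projT1 (cid (H i)).
exists b; apply: IH => i; have Hb : sat q (extend (fun v => e v i) (b i)).
  by rewrite /b; case: cid.
by rewrite (_ : (fun v => _) = extend (fun v => e v i) (b i)) //;
  apply/funext => -[].
Qed.

Lemma expanded_class_P : closed_P (@expanded_class L K F).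
Proof.
move=> I A KA; have [_ _ PK] := VK.
have KP : K (reduct (prod_alg A)).
  by apply: PK (fun i => reduct (A i)) _ => i; have [] := KA i.
exists KP => g x; have [_ _ [phi [ppphi dphi]]] := FK (svalP g).
apply/dphi; apply: (@sat_pp_prod _ (fun i => reduct (A i))) => // i.
have [Ki fi] := KA i.
have /dphi := fi g (fun k => x k i).
by congr sat; apply/funext => -[].
Qed.

(** An ultraproduct is a homomorphic image of a product. *)
Lemma expanded_class_PU : closed_PU (@expanded_class L K F).
Proof.
move=> I U A UU KA; have FU : Filter U by exact: filter_filter.
apply: expanded_class_H (expanded_class_P KA)
  (class_of_hom (ultra_rel_congruence A FU)) _ => S.
by exists (repr_of S); exact: class_of_repr.
Qed.

Lemma pp_expansion_quasivariety : quasivariety (pp_expansion F).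
Proof.
split.
- move=> A B [C [h [KC [hh ih]]]] [k [hk [k' kk' k'k]]].
  have hk' : is_hom k'.
    move=> s x; apply: (can_inj kk'); rewrite hk k'k.
    by congr op; apply/funext => i; rewrite k'k.
  exists C, (h \o k'); split=> //; split; first exact: is_hom_comp.
  exact: inj_comp ih (can_inj k'k).
- move=> A B h [C [k [KC [hk ik]]]] [hh ih].
  exists C, (k \o h); split=> //; split; first exact: is_hom_comp.
  exact: inj_comp.
- move=> I A MA.
  have sB i := cid (MA i); pose B i := projT1 (sB i).
  have sh i := cid (projT2 (sB i)); pose h i : A i -> B i := projT1 (sh i).
  have H i : expanded_class (B i) /\ is_embedding (h i) := projT2 (sh i).
  exists (prod_alg B), (fun x i => h i (x i)); split.
    by apply: expanded_class_P => i; have [] := H i.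
  split=> [s x|x y xy]; apply: functional_extensionality_dep => i;
    have [_ [hi inji]] := H i; first by rewrite /= hi.
  exact: inji (congr1 (fun w => w i) xy).
- move=> I U A UU MA.
  have sB i := cid (MA i); pose B i := projT1 (sB i).
  have sh i := cid (projT2 (sB i)); pose h i : A i -> B i := projT1 (sh i).
  have H i : expanded_class (B i) /\ is_embedding (h i) := projT2 (sh i).
  have FU : Filter U by exact: filter_filter.
  have [k hk] := ultraprod_embedding FU (fun i => (H i).2).
  exists (ultraprod U B), k; split=> //.
  by apply: expanded_class_PU => i; have [] := H i.
Qed.

End PPExpansion.

(** * The expansion by [bd_op] and a quotient that leaves it *)

Definition bd_family (f : pfun V8) : Prop := f = bd_op.

Lemma bd_family_ext_pp (f : pfun V8) : bd_family f -> ext_pp f.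
Proof. by move=> ->; exact: ext_pp_bd_op. Qed.

Definition expA : algebra (expanded_language bd_family) :=
  @Algebra (expanded_language bd_family) A8 (fun s =>
    match s with
    | inl s => fun x => @op LA algA s x
    | inr _ => fun=> e1
    end).

(** No element of B passes the test; the constant value 1 is inherited from [expA], where a4 is the
    witness. *)
Definition expB : algebra (expanded_language bd_family) :=
  @Algebra (expanded_language bd_family) B7 (fun s =>
    match s with
    | inl s => fun x => @op LA algB s x
    | inr _ => fun=> exist (fun a : A8 => not4 a) e1 isT
    end).

Lemma expA_expanded : @expanded_class LA V8 bd_family expA.
Proof.
exists (@variety_generated_mem LA algA) => -[f Ff].
change (f = bd_op) in Ff; subst f => x.
by apply: (proj2 (bd_opP _ _ _)); exists a4.
Qed.

Lemma expB_pp_expansion : pp_expansion bd_family expB.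
Proof.
exists expA, (fun a : B7 => sval a); split; first exact: expA_expanded.
by split=> [[]|[a ha] [b hb] /= ab] //; exact: eq_exist.
Qed.

Lemma theta_congruence_expB : @congruence _ expB theta.
Proof.
have [eqv cong] := theta_congruence; split=> // -[s x y|g x y] xy.
  exact: cong.
by have [rfl _ _] := eqv; exact: rfl.
Qed.

(* In the quotient a6 = 1, so that 0 also passes the test and the added
   operation would have to take the value bd 0 = 0 instead of 1. *)
Lemma expB_quotient : ~ pp_expansion bd_family (@quot_alg _ expB theta).
Proof.
move=> [E [h [[KE fE] [hh ih]]]].
pose k (b : algB) : reduct E := h (@class_of _ expB theta b).
have hk : is_hom k.
  move=> s x; rewrite /k.
  have := class_of_hom theta_congruence_expB (s := inl s) x => /= ->.
  exact: (hh (inl s)).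
have th b b' : k b = k b' <-> theta b b'.
  rewrite /k; split.
    by move=> /ih/(@class_of_eq _ expB _ _ _ theta_equivalence).
  by move=> /(@class_of_eq _ expB _ _ _ theta_equivalence) ->.
pose zero : algB := exist (fun a : A8 => not4 a) e0 isT.
pose g : {f | bd_family f} := exist _ bd_op erefl.
have f0 : pf_fun (p := bd_op) KE (fun=> k zero) = Some (k (bd zero)).
  apply/bd_opP; exists (k zero); last exact: hom_bd.
  by rewrite -(hom_test4 hk) -(hom_one hk); apply/th.
have := fE g (fun=> k zero); rewrite f0 => -[].
have := hh (inr g) (fun=> @class_of _ expB theta zero) => /= <-.
(* The new operation of the quotient yields the class of 1, so [theta] would have to identify 0 with
   1. *)
by move=> /th.
Qed.

Theorem theorem2p1 :
  exists F : pfun (variety_generated_by algA) -> Prop,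
    (forall f : pfun (variety_generated_by algA), F f -> ext_pp f) /\
    proper_quasivariety (pp_expansion F) /\
    ~ congruence_preserving F.
Proof.
exists bd_family; split; first exact: bd_family_ext_pp.
split; first split.
- apply: pp_expansion_quasivariety; last exact: bd_family_ext_pp.
  exact: variety_generated_variety.
- move=> [HM _ _]; apply: expB_quotient.
  apply: HM expB_pp_expansion (class_of_hom theta_congruence_expB) _ => S.
  by exists (repr_of S); exact: class_of_repr.
(* The reduct of [expB] is [algB], and its quotient C lies in V(A); congruence preservation would
   put the quotient of [expB] into the expansion. *)
- move=> cp; apply: expB_quotient.
  have [_ ConK] := cp expB expB_pp_expansion theta.
  by have [] := ConK (conj theta_congruence algC_variety).
Qed.
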